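(* Let $c>0$ and, for complex parameters $\alpha,\beta$ with $\beta\neq 0$, put $$F_0(w)=\alpha-(1-\beta)w,\qquad G_0(w)=\alpha^2+4c\beta^2-2\alpha(1-\beta)w+(1-2\beta)w^2,$$ so that the one-step shift is $S_{\alpha,\beta}(w)=\bigl(F_0(w)+\beta\sqrt{w^2-4c}\bigr)/G_0(w)$. The one-shift condition on $(F_0+\beta\sqrt{w^2-4c})/G_0$ (i.e. that it be of this form) determines the multiplying constant $1-2\beta$ as well as $F_0$ from the roots of $G_0$: (i) If $\deg G_0=2$ and $G_0$ is proportional to $(w-a)(w-b)$ with $a\neq b$, then there are (possibly degenerate) four choices of $(\alpha,\beta)$, with the limit solutions for $a+b=0$ expressed by $$(\alpha,\beta)=\bigl(\pm\sqrt{a^2-4c},\,1\bigr)\quad\text{or}\quad \Bigl(0,\ \frac{a}{a\pm\sqrt{a^2-4c}}\Bigr),$$ including the degenerate unique solution $(\alpha,\beta)=(0,1)$ for $b=-a=\pm2\sqrt{c}$. (ii) If $\deg G_0=2$ and $G_0$ is proportional to $(w-a)^2$, then $$\alpha=a\pm\sqrt{a^2-4c},\qquad \beta=\frac{4c-a^2\mp a\sqrt{a^2-4c}}{4c}$$ (there are two solutions for $a^2\neq 4c$, whereas $\beta=0$ for $a^2=4c$). (iii) If $\deg G_0=1$, then $\beta=1/2$ and $\alpha+c/\alpha$ is the root of $G_0$, which determines $\alpha$ and then $F_0$ up to an exchange $\alpha\leftrightarrow c/\alpha$.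
   Context: For $c>0$, $\rho(w)=\frac{-w+\sqrt{w^2-4c}}{2}$ is the semicircular root, where $\sqrt{w^2-4c}$ (as a function of $w$) is the analytic branch on $\mathbb{C}\setminus[-2\sqrt c,2\sqrt c]$ behaving like $w$ as $w\to\infty$. The one-step shift of $2\rho$ with complex parameters $\alpha$ and $\beta\neq0$ is $S_{\alpha,\beta}(w)=\dfrac{1}{\alpha-w-2\beta\rho(w)}$, which equals $(F_0+\beta\sqrt{w^2-4c})/G_0$ with the $F_0,G_0$ in the claim. Here $a,b$ are complex numbers, and when $\deg G_0=2$ the multiplying constant $1-2\beta$ is the proportionality constant between $G_0$ and $(w-a)(w-b)$. In (ii) upper signs are taken together and lower signs together. *)

(* Defs.v *)
From HB Require Import structures.
From mathcomp Require Import all_boot all_order all_algebra.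
From mathcomp Require Import complex.
From mathcomp Require Import reals.

Set Implicit Arguments.
Unset Strict Implicit.
Unset Printing Implicit Defensive.

Import Order.TTheory GRing.Theory Num.Theory.

Local Open Scope ring_scope.
Local Open Scope complex_scope.

Section OneStepShift.
Variable R : realType.
Implicit Types (c : R) (w alpha beta a b : R[i]).

Definition cut c : pred R[i] :=
  [pred w : R[i] | (complex.Im w == 0) && (`|complex.Re w| <= 2 * Num.sqrt c)].

(* [sqrtc] is the principal square root, discontinuous only across the
   negative reals, where it changes sign.  Below -2 sqrt c both factors change
   sign, so their product is analytic off [cut c]; it is equivalent to w at
   infinity. *)
Definition sqrt_branch c w : R[i] :=
  sqrtc (w - (2 * Num.sqrt c)%:C) * sqrtc (w + (2 * Num.sqrt c)%:C).

Lemma sqr_sqrt_branch c w :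
  0 <= c -> sqrt_branch c w ^+ 2 = w ^+ 2 - 4 * c%:C.
Proof.
move=> c0; rewrite exprMn !sqr_sqrtc -subr_sqr -rmorphXn /= exprMn sqr_sqrtr //.
by rewrite rmorphM rmorphXn /= rmorph_nat -natrX.
Qed.

Definition rho c w : R[i] := (- w + sqrt_branch c w) / 2.

Definition one_step_shift c alpha beta w : R[i] :=
  (alpha - w - 2 * beta * rho c w)^-1.

Definition F0 alpha beta : {poly R[i]} := alpha%:P - (1 - beta) *: 'X.

Definition G0 c alpha beta : {poly R[i]} :=
  (alpha ^+ 2 + 4 * c%:C * beta ^+ 2)%:P - (2 * alpha * (1 - beta)) *: 'X
  + (1 - 2 * beta) *: 'X^2.

(* The parameters (alpha, beta), beta <> 0, for which G_0 has degree d and is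
   proportional to P. *)
Definition choices c (d : nat) (P : {poly R[i]}) : pred (R[i] * R[i]) :=
  [pred x | [&& x.2 != 0, size (G0 c x.1 x.2) == d.+1 & G0 c x.1 x.2 %= P]].

Definition quad a b : {poly R[i]} := ('X - a%:P) * ('X - b%:P).

(* The entries of s are the limits, as (a', b') tends to (a, b), of the
   solutions for the pairs (a', b') that have four distinct ones.  This fixes
   the multiplicities in s when some of the solutions for (a, b) coincide. *)
Definition limit_choices c a b (s : 4.-tuple (R[i] * R[i])) : Prop :=
  forall e : R, 0 < e -> exists2 d : R, 0 < d &
    forall a' b', `|a' - a| < d%:C -> `|b' - b| < d%:C -> a' != b' ->
      a' ^+ 2 != 4 * c%:C -> b' ^+ 2 != 4 * c%:C ->
      exists s' : 4.-tuple (R[i] * R[i]),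
        [/\ uniq s',
            choices c 2 (quad a' b') =i s'
          & forall i, `|(tnth s' i).1 - (tnth s i).1| < e%:C /\
                      `|(tnth s' i).2 - (tnth s i).2| < e%:C].

Definition four_choices c a b (s : 4.-tuple (R[i] * R[i])) : Prop :=
  choices c 2 (quad a b) =i s /\ limit_choices c a b s.

End OneStepShift.

(* Main.v *)
(* Writing alpha = (x + y) / 2 and beta = (k - x y) / (2 k) with k = 4 c, so that
   x and y are the roots of t^2 - 2 alpha t + k (1 - 2 beta), one has
   G_0(w) = (2 x w - x^2 - k) (2 y w - y^2 - k) / (4 k).  Hence G_0 is
   proportional to (w - a)(w - b) exactly when x = a +- sqrt(a^2 - k) and
   y = b +- sqrt(b^2 - k) up to exchanging x and y, while beta <> 0 means
   x y <> k.  For a <> b all four sign choices are admissible, and their limits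
   follow by tracking the square roots continuously; for a = b only the equal
   signs survive, since the two values a +- sqrt(a^2 - k) have product k. *)
Require Import Defs.
From HB Require Import structures.
From mathcomp Require Import all_boot all_order all_algebra.
From mathcomp Require Import complex.
From mathcomp Require Import reals ring lra.

Import Order.TTheory GRing.Theory Num.Theory.
Local Open Scope ring_scope.
Local Open Scope complex_scope.

(** The distances from r to the two square roots of z have product |z - r^2|, so the square of the
    smaller one is at most that. This replaces continuity of a fixed branch, which fails across the
    cut of [sqrtC]. *)
Lemma sqrt_near (F : numClosedFieldType) (r z : F) :
  exists2 s : F, s ^+ 2 = z & `|s - r| ^+ 2 <= `|z - r ^+ 2|.
Proof.
have zE : `|z - r ^+ 2| = `|sqrtC z - r| * `|sqrtC z + r|.
  by rewrite -normrM -subr_sqr sqrtCK.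
case: (real_leP (normr_real (sqrtC z - r)) (normr_real (sqrtC z + r))) => le.
  by exists (sqrtC z); rewrite ?sqrtCK // zE expr2 ler_wpM2l.
exists (- sqrtC z); first by rewrite sqrrN sqrtCK.
by rewrite zE -opprD normrN expr2 ler_wpM2r // ltW.
Qed.

Section Choices.
Variables (R : realType) (c : R).
Hypothesis c_gt0 : 0 < c.
Implicit Types (a b r s x y alpha beta w : R[i]) (z : R[i] * R[i]).
Local Notation k := (4 * c%:C).
Local Notation normc := ComplexField.Normc.normc.

Let c_neq0 : c%:C != 0 :> R[i].
Proof. by rewrite fmorph_eq0 gt_eqF. Qed.

Let k_neq0 : k != 0 :> R[i].
Proof. by rewrite mulf_neq0 // pnatr_eq0. Qed.

(** * Coefficients of G_0 and the parametrisation by x and y *)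

Definition shift_params x y : R[i] * R[i] := ((x + y) / 2, (k - x * y) / (2 * k)).

Lemma G0_coef alpha beta :
  [/\ (G0 c alpha beta)`_0 = alpha ^+ 2 + k * beta ^+ 2,
      (G0 c alpha beta)`_1 = - (2 * alpha * (1 - beta)),
      (G0 c alpha beta)`_2 = 1 - 2 * beta
    & forall i, (2 < i)%N -> (G0 c alpha beta)`_i = 0].
Proof.
rewrite /G0; split=> [||| i lt2i];
  rewrite !(coefD, coefB, coefN, coefZ, coefC, coefX, coefXn) /=; try by ring.
by case: i lt2i => [|[|[|i]]] //= _; ring.
Qed.

Lemma size_G0 alpha beta : (size (G0 c alpha beta) <= 3)%N.
Proof. by apply/leq_sizeP => i; have [_ _ _] := G0_coef alpha beta; exact. Qed.

Lemma size_G0_eq3 alpha beta :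
  (size (G0 c alpha beta) == 3%N) = (1 - 2 * beta != 0).
Proof.
have [_ _ <- _] := G0_coef alpha beta.
apply/eqP/idP => [sz | nz].
  by have := lead_coef_eq0 (G0 c alpha beta); rewrite lead_coefE sz /= => ->;
     rewrite -size_poly_eq0 sz.
apply/eqP; rewrite eqn_leq size_G0 ltnNge; apply: contra nz => /leq_sizeP.
by move=> -> .
Qed.

Lemma quadE a b : quad a b = (a * b)%:P - (a + b) *: 'X + 'X^2.
Proof. by rewrite /quad -mul_polyC rmorphD rmorphM /=; ring. Qed.

Lemma G0_eq_quad alpha beta a b :
  G0 c alpha beta = (1 - 2 * beta) *: quad a b <->
  alpha ^+ 2 + k * beta ^+ 2 = (1 - 2 * beta) * (a * b) /\
  2 * alpha * (1 - beta) = (1 - 2 * beta) * (a + b).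
Proof.
rewrite quadE /G0 !scalerDr scalerN scalerA -!mul_polyC -polyCM; split.
  move=> /polyP eqp; split.
    by move: (eqp 0); rewrite !(coefD, coefN, coefCM, coefC, coefX, coefXn) /= ;
       rewrite !(mulr0, oppr0, addr0).
  move: (eqp 1); rewrite !(coefD, coefN, coefCM, coefC, coefX, coefXn) /=.
  by rewrite !(mulr0, mulr1, addr0, add0r) => /oppr_inj.
by case=> -> ->.
Qed.

Lemma G0_choices a b z : z \in choices c 2 (quad a b) ->
  G0 c z.1 z.2 = (1 - 2 * z.2) *: quad a b.
Proof.
(* [quad a b] is monic, so the coefficient of X^2 identifies the factor l with 1 - 2 beta. *)
move=> /and3P[_ _ /eqpf_eq[l _ eqG]].
have [_ _ G2 _] := G0_coef z.1 z.2; move: G2; rewrite {1}eqG => <-.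
by rewrite eqG quadE !(coefD, coefN, coefZ, coefC, coefX, coefXn) /= mulr0
           oppr0 !add0r mulr1.
Qed.

(** The equation x^2 + k = 2 a x says that a = (x^2 + k) / (2 x), the root of the linear factor of
    G_0 attached to x; likewise for b and y. *)
Lemma choicesP a b z : z \in choices c 2 (quad a b) <->
  exists x y, [/\ x ^+ 2 + k = 2 * a * x, y ^+ 2 + k = 2 * b * y,
                  x * y != k & z = shift_params x y].
Proof.
split.
  move=> zin; have /G0_eq_quad := G0_choices _ _ _ zin.
  move: zin; rewrite inE size_G0_eq3; case: z => alpha beta /=.
  move=> /and3P[beta0 beta12 _] [G00 G01].
  set x := alpha + sqrtC (alpha ^+ 2 - k * (1 - 2 * beta)).
  set y := alpha - sqrtC (alpha ^+ 2 - k * (1 - 2 * beta)).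
  have alphaE : alpha = (x + y) / 2 by rewrite /x /y; field.
  have xyE : x * y = k * (1 - 2 * beta).
    by rewrite mulrC -subr_sqr sqrtCK; ring.
  have betaE : beta = (k - x * y) / (2 * k) by rewrite xyE; field.
  have xy0 : x * y != 0 by rewrite xyE mulf_neq0.
  have xyk : x * y != k.
    by apply: contra beta0 => /eqP xyk; rewrite betaE xyk subrr mul0r.
  have zE : (alpha, beta) = shift_params x y.
    by rewrite /shift_params -alphaE -betaE.
  (* Put A = (x^2 + k) / (2 x) and B = (y^2 + k) / (2 y). Cleared of denominators, [e0] says A B = a
     b and [e1] says A + B = a + b. *)
  have e0 : (x ^+ 2 + k) * (y ^+ 2 + k) = 4 * (x * y) * (a * b).
    have <- : 4 * k * ((1 - 2 * beta) * (a * b)) = 4 * (x * y) * (a * b).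
      by rewrite xyE; ring.
    by rewrite -G00 alphaE betaE; field.
  have e1 : (x ^+ 2 + k) * y + x * (y ^+ 2 + k) = 2 * (x * y) * (a + b).
    have <- : 2 * k * ((1 - 2 * beta) * (a + b)) = 2 * (x * y) * (a + b).
      by rewrite xyE; ring.
    by rewrite -G01 alphaE betaE; field.
  (* This is (A - a)(B - a) = 0 times 4 x y. Once A or B equals a, the sum [e1] makes the other
     equal to b. *)
  have : (x ^+ 2 + k - 2 * a * x) * (y ^+ 2 + k - 2 * a * y) = 0.
    transitivity ((x ^+ 2 + k) * (y ^+ 2 + k)
      - 2 * a * ((x ^+ 2 + k) * y + x * (y ^+ 2 + k)) + 4 * a ^+ 2 * (x * y)).
      by ring.
    by rewrite e0 e1; ring.
  move: xy0; rewrite mulf_eq0 negb_or => /andP[x0 y0].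
  move=> /eqP; rewrite mulf_eq0 !subr_eq0 => /orP[] /eqP ea.
    exists x, y; split=> //; apply: (mulfI x0).
    move: e1; rewrite ea => e1.
    by apply: (addrI (2 * a * x * y)); rewrite e1; ring.
  (* If B = a, the roles of x and y are exchanged; [shift_params] is symmetric. *)
  exists y, x; split=> //; last first.
  - by rewrite zE /shift_params addrC [x * y]mulrC.
  - by rewrite mulrC.
  apply: (mulIf y0); move: e1; rewrite ea => e1.
  by apply: (addIr (x * (2 * a * y))); rewrite e1; ring.
move=> [x [y [ea eb xyk ->]]].
have x0 : x != 0.
  by apply: contraNneq k_neq0 => x0; move/eqP: ea; rewrite x0 expr0n mulr0 add0r.
have y0 : y != 0.
  by apply: contraNneq k_neq0 => y0; move/eqP: eb; rewrite y0 expr0n mulr0 add0r.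
have aE : a = (x ^+ 2 + k) / (2 * x) by rewrite ea; field.
have bE : b = (y ^+ 2 + k) / (2 * y) by rewrite eb; field.
have lE : 1 - 2 * (shift_params x y).2 = x * y / k by rewrite /=; field.
have l0 : 1 - 2 * (shift_params x y).2 != 0.
  by rewrite lE !mulf_neq0 ?invr_neq0.
rewrite inE size_G0_eq3 l0; apply/and3P; split=> //.
  by rewrite mulf_neq0 ?invr_neq0 ?mulf_neq0 ?pnatr_eq0 // subr_eq0 eq_sym.
suff -> : G0 c (shift_params x y).1 (shift_params x y).2
    = (1 - 2 * (shift_params x y).2) *: quad a b by apply: eqp_scale.
by apply/G0_eq_quad; rewrite lE aE bE /=; split; field;
   rewrite ?x0 ?y0 ?c_neq0.
Qed.

(** * The four sign choices and their distinctness *)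

(** Equal signs come first, so that for b = -a and s = r the entries appear in the order (r, 1),
    (-r, 1), then the two solutions with alpha = 0. *)
Definition branches a b r s : seq (R[i] * R[i]) :=
  [:: (a + r, b + s); (a - r, b - s); (a - r, b + s); (a + r, b - s)].

Definition branch_choices a b r s : 4.-tuple (R[i] * R[i]) :=
  [tuple shift_params (a + r) (b + s); shift_params (a - r) (b - s);
         shift_params (a - r) (b + s); shift_params (a + r) (b - s)].

Lemma branch_choicesE a b r s :
  branch_choices a b r s =
    [seq shift_params z.1 z.2 | z <- branches a b r s] :> seq _.
Proof. by []. Qed.

Lemma branchP a r x : r ^+ 2 = a ^+ 2 - k ->
  x ^+ 2 + k = 2 * a * x <-> x = a + r \/ x = a - r.
Proof.
move=> rE; split; last first.
  by case=> ->; rewrite (sqrrD, sqrrB) ?sqrrN rE; ring.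
move=> e; have /eqP : (x - a) ^+ 2 = r ^+ 2.
  by rewrite rE sqrrB -[x ^+ 2](addrK k) e; ring.
rewrite eqf_sqr !subr_eq => /orP[] /eqP ->; first by left; rewrite addrC.
by right; rewrite addrC.
Qed.

Lemma branch_neq0 a x : x ^+ 2 + k = 2 * a * x -> x != 0.
Proof.
move=> e; apply: contraNneq k_neq0 => x0.
by move/eqP: e; rewrite x0 expr0n mulr0 add0r.
Qed.

Lemma branch_inj a b x : x ^+ 2 + k = 2 * a * x -> x ^+ 2 + k = 2 * b * x -> a = b.
Proof.
move=> ea; rewrite ea => /(mulIf (branch_neq0 _ _ ea)).
by apply: mulfI; rewrite pnatr_eq0.
Qed.

(** Replacing k by x y and cancelling x, respectively y, gives 2 a = x + y = 2 b. Hence a != b rules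
    out beta = 0. *)
Lemma branch_mul_eq a b x y : x ^+ 2 + k = 2 * a * x -> y ^+ 2 + k = 2 * b * y ->
  x * y = k -> a = b.
Proof.
move=> ea eb xyk; have x0 := branch_neq0 _ _ ea; have y0 := branch_neq0 _ _ eb.
have n2 : 2 != 0 :> R[i] by rewrite pnatr_eq0.
have : x + y = 2 * a by apply: (mulIf x0); rewrite -ea -xyk; ring.
have -> : x + y = 2 * b by apply: (mulIf y0); rewrite -eb -xyk; ring.
by move=> /(mulfI n2).
Qed.

Lemma mem_branches a b r s z : r ^+ 2 = a ^+ 2 - k -> s ^+ 2 = b ^+ 2 - k ->
  z \in branches a b r s <->
  z.1 ^+ 2 + k = 2 * a * z.1 /\ z.2 ^+ 2 + k = 2 * b * z.2.
Proof.
move=> rE sE; case: z => x y; rewrite (branchP _ _ _ rE) (branchP _ _ _ sE) /=.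
rewrite !inE !xpair_eqE; split.
  by case/or4P=> /andP[/eqP -> /eqP ->]; auto.
by case=> [[] ->] [] ->; rewrite !eqxx ?orbT.
Qed.

Lemma choices_branch a b r s : a != b ->
  r ^+ 2 = a ^+ 2 - k -> s ^+ 2 = b ^+ 2 - k ->
  choices c 2 (quad a b) =i branch_choices a b r s.
Proof.
move=> ab rE sE z; rewrite memtE branch_choicesE; apply/idP/idP.
  move=> /choicesP[x [y [ea eb _ ->]]].
  by apply: (map_f (fun z => shift_params z.1 z.2) (x := (x, y))); apply/mem_branches.
move=> /mapP[[x y] /(mem_branches _ _ _ _ _ rE sE)[/= ea eb] ->].
apply/choicesP; exists x, y; split=> //.
by apply: contra_neq ab; exact: branch_mul_eq ea eb.
Qed.

(** The parameters determine the sum and the product, hence the unordered pair. *)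
Lemma shift_params_inj x y x' y' : shift_params x y = shift_params x' y' ->
  (x = x' /\ y = y') \/ (x = y' /\ y = x').
Proof.
case=> e1 e2.
have n2 : 2^-1 != 0 :> R[i] by rewrite invr_neq0 ?pnatr_eq0.
have n2k : (2 * k)^-1 != 0 by rewrite invr_neq0 ?mulf_neq0 ?pnatr_eq0.
move: e1 => /(mulIf n2) sumE; move: e2 => /(mulIf n2k) /addrI /oppr_inj prodE.
have : (x - x') * (x - y') = 0.
  transitivity (x ^+ 2 - x * (x' + y') + x' * y'); first by ring.
  by rewrite -sumE -prodE; ring.
move=> /eqP; rewrite mulf_eq0 !subr_eq0 => /orP[] /eqP ex.
  by left; split=> //; apply: (addrI x); rewrite sumE ex.
by right; split=> //; apply: (addrI x); rewrite sumE ex addrC.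
Qed.

Lemma uniq_branch_choices a b r s : a != b ->
  r ^+ 2 = a ^+ 2 - k -> s ^+ 2 = b ^+ 2 - k ->
  uniq (branch_choices a b r s) = (r != 0) && (s != 0).
Proof.
move=> ab rE sE; rewrite branch_choicesE map_inj_in_uniq; last first.
  move=> [x y] [x' y'] /(mem_branches _ _ _ _ _ rE sE)[/= ea eb].
  move=> /(mem_branches _ _ _ _ _ rE sE)[/= ea' eb'].
  (* In the exchanged case x = y' solves the equations of both a and b, which forces a = b. *)
  case/shift_params_inj=> [[-> ->] // | [ex _]].
  by move: ab; rewrite (branch_inj a b x) ?eqxx // ex.
have D (u v : R[i]) : (u + v == u - v) = (v == 0).
  by rewrite (inj_eq (addrI u)) eq_sym eqNr.
have D' (u v : R[i]) : (u - v == u + v) = (v == 0) by rewrite eq_sym D.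
by rewrite /= !inE !xpair_eqE !D !D' !eqxx; case: (r == 0); case: (s == 0).
Qed.

(** * Norm estimates and limits of the solutions *)

(** The norm on [R[i]] is complex-valued; estimates are moved to the real-valued [normc], where
    [lra] applies. *)
Let normE (z : R[i]) : `|z| = (normc z)%:C. Proof. by []. Qed.

Let normc_ge0 (z : R[i]) : 0 <= normc z.
Proof. by case: z => u v; exact: sqrtr_ge0. Qed.

Let normc_real (t : R) : 0 <= t -> normc t%:C = t.
Proof. by move=> t0; apply: complexI; rewrite -normE ger0_norm // lecR. Qed.

Let normcD (u v : R[i]) : normc (u + v) <= normc u + normc v.
Proof. exact: le_normcD. Qed.

Let normcN (u : R[i]) : normc (- u) = normc u.
Proof. exact: normcN. Qed.

Lemma shift_params_near x y (e : R) : 0 < e -> exists2 d : R, 0 < d &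
  forall x' y', `|x' - x| < d%:C -> `|y' - y| < d%:C ->
    `|(shift_params x' y').1 - (shift_params x y).1| < e%:C /\
    `|(shift_params x' y').2 - (shift_params x y).2| < e%:C.
Proof.
move=> e0.
have nx := normc_ge0 x; have ny := normc_ge0 y.
(* L bounds the variation of beta per unit of d when d < 1, as 2 k = 8 c. The choice d = e / (e + 1
   + L) gives d < 1, d < e and d L < e at once. *)
pose L := (normc x + normc y + 1) / (8 * c).
have c8 : 0 < 8 * c by rewrite mulr_gt0.
have L0 : 0 < L by rewrite divr_gt0 //; lra.
have S0 : 0 < e + 1 + L by lra.
pose d := e / (e + 1 + L).
have d0 : 0 < d by rewrite divr_gt0.
have dE : d * (e + 1 + L) = e by rewrite divfK ?gt_eqF.
have de := mulr_gt0 d0 e0; have dL := mulr_gt0 d0 L0.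
have d_lt_e : d < e by lra.
have d_lt1 : d < 1 by rewrite ltr_pdivrMr //; lra.
have dM : d * (normc x + normc y + 1) < e * (8 * c).
  have -> : normc x + normc y + 1 = L * (8 * c).
    by rewrite divfK // mulf_neq0 ?pnatr_eq0 ?gt_eqF.
  by rewrite (mulrA d) ltr_pM2r //; lra.
exists d => // x' y'; rewrite !normE !ltcR.
set dx := x' - x; set dy := y' - y => lt_dx lt_dy.
have ndx := normc_ge0 dx; have ndy := normc_ge0 dy; split.
  set t := (_ - _); have tE : 2%:C * t = dx + dy.
    by rewrite rmorph_nat /t /dx /dy /=; field.
  have := normcD dx dy; rewrite -tE ComplexField.Normc.normcM normc_real //; lra.
set t := (_ - _).
have tE : (8 * c)%:C * - t = dx * y + x * dy + dx * dy.
  by rewrite rmorphM rmorph_nat /t /dx /dy /=; field.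
have t8 : 8 * c * normc t <=
    normc dx * normc y + normc x * normc dy + normc dx * normc dy.
  rewrite -(normcN t) -[X in X * _]normc_real ?(ltW c8) //.
  rewrite -!ComplexField.Normc.normcM tE.
  by have := normcD (dx * y + x * dy) (dx * dy);
     have := normcD (dx * y) (x * dy); lra.
rewrite -(ltr_pM2l c8); apply: le_lt_trans t8 _; rewrite [ltRHS]mulrC.
apply: le_lt_trans dM.
have : normc dx * normc y <= d * normc y by rewrite ler_wpM2r // ltW.
have : normc x * normc dy <= normc x * d by rewrite ler_wpM2l // ltW.
have : normc dx * normc dy <= d * 1 by rewrite ler_pM // ltW // (lt_trans lt_dy).
lra.
Qed.

(** The root r' of a'^2 - k is the one near r supplied by [sqrt_near], so both signs are followed
    together, also when r = 0. *)
Lemma root_near a r (e : R) : 0 < e -> r ^+ 2 = a ^+ 2 - k ->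
  exists2 d : R, 0 < d & forall a', `|a' - a| < d%:C ->
    exists r', [/\ r' ^+ 2 = a' ^+ 2 - k, `|a' + r' - (a + r)| < e%:C
                 & `|a' - r' - (a - r)| < e%:C].
Proof.
move=> e0 rE.
have na := normc_ge0 a.
(* With d = e^2 / S, the three summands yield in turn d < 1, d < e / 2 and d (2 |a| + 1) <= (e /
   2)^2. *)
pose S := e ^+ 2 + 2 * e + 4 * (2 * normc a + 1).
have e2_gt0 : 0 < e ^+ 2 by rewrite exprn_gt0.
have S_gt0 : 0 < S by rewrite /S; lra.
pose d := e ^+ 2 / S.
have d_gt0 : 0 < d by rewrite divr_gt0.
have dS : d * S = e ^+ 2 by rewrite divfK ?gt_eqF.
have de2 := mulr_gt0 d_gt0 e2_gt0.
have de := mulr_gt0 d_gt0 e0.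
have dna := mulr_ge0 (ltW d_gt0) na.
have d_lt1 : d < 1 by rewrite ltr_pdivrMr // /S; lra.
have d_lte : d < e / 2 by rewrite ltr_pdivrMr // /S; nra.
have dA : d * (2 * normc a + 1) <= (e / 2) ^+ 2.
  by move: dS; rewrite /S expr_div_n; lra.
exists d => // a'; rewrite normE ltcR => lt_da.
have [r' r'E near] := sqrt_near _ r (a' ^+ 2 - k).
have nda := normc_ge0 (a' - a); have ndr := normc_ge0 (r' - r).
have dr : normc (r' - r) <= e / 2.
  rewrite -(@ler_pXn2r _ 2) ?nnegrE //; last by lra.
  apply: le_trans dA.
  (* This difference bounds |r' - r|^2; its second factor has norm at most 2 |a| + 1 because d <
     1. *)
  have sqE : a' ^+ 2 - k - r ^+ 2 = (a' - a) * ((a' - a) + 2%:C * a).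
    by rewrite rE rmorph_nat; ring.
  move: near; rewrite !normE -rmorphXn lecR sqE ComplexField.Normc.normcM.
  have := normcD (a' - a) (2%:C * a).
  rewrite ComplexField.Normc.normcM normc_real // => le_n le_r.
  apply: le_trans le_r _; apply: ler_pM => //; lra.
exists r'; split=> //; rewrite normE ltcR.
  have -> : a' + r' - (a + r) = (a' - a) + (r' - r) by ring.
  by have := normcD (a' - a) (r' - r); lra.
have -> : a' - r' - (a - r) = (a' - a) + - (r' - r) by ring.
by have := normcD (a' - a) (- (r' - r)); rewrite normcN; lra.
Qed.

Lemma branch_choices_limit a b r s :
  r ^+ 2 = a ^+ 2 - k -> s ^+ 2 = b ^+ 2 - k ->
  limit_choices c a b (branch_choices a b r s).
Proof.
move=> rE sE e e0.
have [d1 d1_gt0 near1] := shift_params_near (a + r) (b + s) e e0.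
have [d2 d2_gt0 near2] := shift_params_near (a - r) (b - s) e e0.
have [d3 d3_gt0 near3] := shift_params_near (a - r) (b + s) e e0.
have [d4 d4_gt0 near4] := shift_params_near (a + r) (b - s) e e0.
(* One tolerance for all four entries, since they share the same perturbed roots r' and s'. *)
pose d := Num.min (Num.min d1 d2) (Num.min d3 d4).
have d_gt0 : 0 < d by rewrite !lt_min d1_gt0 d2_gt0 d3_gt0.
have dle (t : R[i]) : t < d%:C -> [/\ t < d1%:C, t < d2%:C, t < d3%:C & t < d4%:C].
  by move=> td; split; apply: lt_le_trans td _; rewrite lecR !ge_min lexx ?orbT.
have [da da_gt0 neara] := root_near a r d d_gt0 rE.
have [db db_gt0 nearb] := root_near b s d d_gt0 sE.
exists (Num.min da db); first by rewrite lt_min da_gt0.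
move=> a' b' a'a b'b ab' a'k b'k.
have /neara[r' [r'E /dle[? ? ? ?] /dle[? ? ? ?]]] : `|a' - a| < da%:C.
  by apply: lt_le_trans a'a _; rewrite lecR ge_min lexx.
have /nearb[s' [s'E /dle[? ? ? ?] /dle[? ? ? ?]]] : `|b' - b| < db%:C.
  by apply: lt_le_trans b'b _; rewrite lecR ge_min lexx orbT.
exists (branch_choices a' b' r' s'); split.
- rewrite uniq_branch_choices // -(sqrf_eq0 r') -(sqrf_eq0 s') r'E s'E !subr_eq0.
  by rewrite a'k b'k.
- exact: choices_branch.
case=> [[|[|[|[|i]]]]] // lt_i; rewrite !(tnth_nth (0, 0)).
- exact: near1.
- exact: near2.
- exact: near3.
- exact: near4.
Qed.

Lemma branch_four_choices a b r s : a != b ->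
  r ^+ 2 = a ^+ 2 - k -> s ^+ 2 = b ^+ 2 - k ->
  four_choices c a b (branch_choices a b r s).
Proof.
by move=> ab rE sE; split; [exact: choices_branch | exact: branch_choices_limit].
Qed.

(** * The cases b = -a and b = a *)

Lemma opp_branch_choices a r : r ^+ 2 = a ^+ 2 - k ->
  branch_choices a (- a) r r =
  [tuple (r, 1); (- r, 1); (0, a / (a + r)); (0, a / (a - r))].
Proof.
move=> rE.
have kE : k = a ^+ 2 - r ^+ 2 by rewrite rE; ring.
(* k = (a - r)(a + r) is nonzero, so neither denominator vanishes. *)
have := k_neq0; rewrite kE subr_sqr mulf_eq0 negb_or => /andP[nm np].
apply: val_inj; rewrite /= /shift_params kE.
by congr [:: (_, _); (_, _); (_, _); (_, _)]; field; rewrite -?subr_sqr -?kE ?nm ?np.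
Qed.

(** Opposite signs give x y = (a + r)(a - r) = k, which is excluded. Equal signs give (a + r)^2 or
    (a - r)^2, each equal to k exactly when r = 0. *)
Lemma choices_diag a r : r ^+ 2 = a ^+ 2 - k ->
  choices c 2 (quad a a) =i
  if r == 0 then [::]
  else [:: shift_params (a + r) (a + r); shift_params (a - r) (a - r)].
Proof.
move=> rE z.
have kE : k = (a + r) * (a - r) by rewrite [RHS]mulrC -subr_sqr rE; ring.
have := k_neq0; rewrite kE mulf_eq0 negb_or => /andP[np nm].
have pE : ((a + r) * (a + r) == k) = (r == 0).
  by rewrite kE (inj_eq (mulfI np)) (inj_eq (addrI a)) eq_sym eqNr.
have mE : ((a - r) * (a - r) == k) = (r == 0).
  by rewrite kE (inj_eq (mulIf nm)) (inj_eq (addrI a)) eqNr.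
apply/idP/idP.
  move=> /choicesP[x [y [/(branchP _ _ _ rE) ex /(branchP _ _ _ rE) ey xyk ->]]].
  move: xyk; case: ex => ->; case: ey => ->; rewrite ?pE ?mE.
  - by move=> /negPf ->; rewrite !inE eqxx.
  - by rewrite -kE eqxx.
  - by rewrite mulrC -kE eqxx.
  - by move=> /negPf ->; rewrite !inE eqxx orbT.
case: eqP => // /eqP r0; rewrite !inE => /orP[] /eqP ->; apply/choicesP.
  by exists (a + r), (a + r); rewrite pE; split=> //; apply/(branchP _ _ _ rE); left.
by exists (a - r), (a - r); rewrite mE; split=> //; apply/(branchP _ _ _ rE); right.
Qed.

(** * Rationalising the denominator of the shift *)

Lemma one_step_shiftE alpha beta w : (G0 c alpha beta).[w] != 0 ->
  one_step_shift c alpha beta w =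
  ((F0 alpha beta).[w] + beta * sqrt_branch c w) / (G0 c alpha beta).[w].
Proof.
(* The first factor is the denominator alpha - w - 2 beta rho(w) of the shift, and the second is its
   conjugate. *)
have G0E : (G0 c alpha beta).[w] =
    ((F0 alpha beta).[w] - beta * sqrt_branch c w) *
    ((F0 alpha beta).[w] + beta * sqrt_branch c w).
  rewrite -subr_sqr exprMn sqr_sqrt_branch ?ltW // /G0 /F0.
  by rewrite !(hornerD, hornerN, hornerC, hornerZ, hornerX, hornerXn); ring.
rewrite G0E mulf_eq0 negb_or => /andP[nm np].
rewrite invfM mulrCA mulfV // mulr1 /one_step_shift; congr (_^-1).
by rewrite /F0 /rho !(hornerD, hornerN, hornerC, hornerZ, hornerX); field.
Qed.

(** * Degree one *)

Lemma G0_half alpha : alpha != 0 ->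
  G0 c alpha (1 / 2) = (- alpha) *: ('X - (alpha + c%:C / alpha)%:P).
Proof.
move=> alpha0; apply/polyP => i.
rewrite /G0 !(coefD, coefB, coefN, coefZ, coefC, coefX, coefXn).
by case: i => [|[|[|i]]] /=; field.
Qed.

Lemma size_G0_eq2 alpha beta : size (G0 c alpha beta) = 2%N ->
  beta = 1 / 2 /\ alpha != 0.
Proof.
move=> sz; have := size_G0_eq3 alpha beta; rewrite sz => /esym/negbFE/eqP b12.
have betaE : beta = 1 / 2.
  have -> : beta = (1 - (1 - 2 * beta)) / 2 by field.
  by rewrite b12 subr0.
split=> //; apply: contra_eq_neq sz => a0; rewrite betaE.
(* With alpha = 0 the polynomial would be a nonzero constant, of size 1 instead of 2. *)
have -> : G0 c alpha (1 / 2) = c%:C%:P.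
  apply/polyP => i; rewrite /G0 !(coefD, coefN, coefZ, coefC, coefX, coefXn) a0.
  by case: i => [|[|[|i]]] /=; field.
by rewrite size_polyC c_neq0.
Qed.

Lemma choices_deg1 alpha : alpha != 0 ->
  choices c 1 ('X - (alpha + c%:C / alpha)%:P)
    =i [:: (alpha, 1 / 2); (c%:C / alpha, 1 / 2)].
Proof.
move=> alpha0 [alpha' beta']; set w := alpha + c%:C / alpha.
have half_in (t : R[i]) : t != 0 -> t + c%:C / t = w ->
    (t, 1 / 2) \in choices c 1 ('X - w%:P).
  move=> t0 tw; rewrite inE /= G0_half // tw size_scale ?oppr_eq0 // size_XsubC.
  by rewrite eqp_scale ?oppr_eq0 // mulf_neq0 ?oner_eq0 ?invr_neq0 ?pnatr_eq0.
apply/idP/idP.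
  move=> /and3P[/= _ /eqP /size_G0_eq2[-> a0']].
  rewrite G0_half // => /eqp_root/(_ w).
  rewrite rootZ ?oppr_eq0 // !root_XsubC eqxx !inE !xpair_eqE !eqxx !andbT.
  move=> /eqP wE.
  (* The equation alpha' + c / alpha' = w, multiplied by alpha', is a quadratic with roots alpha and
     c / alpha. *)
  have /eqP : (alpha' - alpha) * (alpha' - c%:C / alpha) = 0.
    transitivity (alpha' * (alpha' + c%:C / alpha' - w)).
      by rewrite /w; field; rewrite a0' alpha0.
    by rewrite wE subrr mulr0.
  by rewrite mulf_eq0 !subr_eq0.
rewrite !inE => /orP[] /eqP[-> ->]; apply: half_in => //.
  by rewrite mulf_neq0 ?invr_neq0.
by rewrite /w; field; rewrite alpha0 c_neq0.
Qed.
End Choices.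

(** * Assembling the classification *)

Theorem proposition4p1 (R : realType) (c : R) (c_gt0 : 0 < c) :
  (* the one-step shift in terms of F_0 and G_0 *)
  (forall alpha beta w : R[i], beta != 0 -> w \notin cut c ->
     (G0 c alpha beta).[w] != 0 ->
     one_step_shift c alpha beta w =
       ((F0 alpha beta).[w] + beta * sqrt_branch c w) / (G0 c alpha beta).[w])
  /\
  (* the multiplying constant *)
  (forall (a b : R[i]) (x : R[i] * R[i]), x \in choices c 2 (quad a b) ->
     G0 c x.1 x.2 = (1 - 2 * x.2) *: quad a b)
  /\
  (* (i) *)
  [/\ forall a b : R[i], a != b ->
        exists2 s : 4.-tuple (R[i] * R[i]), four_choices c a b s &
          (uniq s <-> a ^+ 2 != 4 * c%:C /\ b ^+ 2 != 4 * c%:C),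
      forall a b r : R[i], a != b -> a + b = 0 -> r ^+ 2 = a ^+ 2 - 4 * c%:C ->
        four_choices c a b [tuple (r, 1); (- r, 1);
                                  (0, a / (a + r)); (0, a / (a - r))]
    & forall a b : R[i], b = - a ->
        b = (2 * Num.sqrt c)%:C \/ b = - (2 * Num.sqrt c)%:C ->
        choices c 2 (quad a b) =i [:: (0, 1)]]
  /\
  (* (ii) *)
  (forall a r : R[i], r ^+ 2 = a ^+ 2 - 4 * c%:C ->
     let xp := (a + r, (4 * c%:C - a ^+ 2 - a * r) / (4 * c%:C)) in
     let xm := (a - r, (4 * c%:C - a ^+ 2 + a * r) / (4 * c%:C)) in
     (a ^+ 2 != 4 * c%:C ->
        xp != xm /\ choices c 2 (quad a a) =i [:: xp; xm])
     /\
     (a ^+ 2 = 4 * c%:C ->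
        [/\ xp.2 = 0, xm.2 = 0 &
            forall alpha beta : R[i], size (G0 c alpha beta) = 3%N ->
              G0 c alpha beta %= quad a a -> beta = 0]))
  /\
  (* (iii) *)
  (forall alpha beta : R[i], beta != 0 -> size (G0 c alpha beta) = 2%N ->
     [/\ beta = 1 / 2, alpha != 0,
         forall w : R[i], root (G0 c alpha beta) w = (w == alpha + c%:C / alpha)
       & choices c 1 ('X - (alpha + c%:C / alpha)%:P)
           =i [:: (alpha, 1 / 2); (c%:C / alpha, 1 / 2)]]).
Proof.
have k0 : 4 * c%:C != 0 :> R[i].
  by rewrite mulf_neq0 ?pnatr_eq0 // fmorph_eq0 gt_eqF.
split; first by move=> alpha beta w _ _; exact: one_step_shiftE.
split; first exact: G0_choices.
split.
  split.
  - move=> a b ab.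
    have rE := sqrtCK (a ^+ 2 - 4 * c%:C); have sE := sqrtCK (b ^+ 2 - 4 * c%:C).
    exists (branch_choices _ c a b (sqrtC (a ^+ 2 - 4 * c%:C))
                               (sqrtC (b ^+ 2 - 4 * c%:C))).
      exact: branch_four_choices.
    by rewrite uniq_branch_choices // !sqrtC_eq0 !subr_eq0; split=> /andP.
  - move=> a b r ab /eqP; rewrite addr_eq0 -eqr_oppLR => /eqP bE rE.
    (* Since b^2 = a^2, the given r also serves as the root s for b. *)
    rewrite -bE -(opp_branch_choices _ _ c_gt0) //; apply: branch_four_choices => //.
      by rewrite bE.
    by rewrite sqrrN.
  - move=> a b bE b2.
    have a2 : a ^+ 2 = 4 * c%:C.
      have -> : a ^+ 2 = (2 * Num.sqrt c)%:C ^+ 2.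
        by rewrite -[a]opprK -bE sqrrN; case: b2 => ->; rewrite ?sqrrN.
      by rewrite -rmorphXn /= exprMn sqr_sqrtr ?ltW // -natrX rmorphM /= rmorph_nat.
    have a0 : a != 0 by apply: contraNneq k0 => a0; rewrite -a2 a0 expr0n.
    have ab : a != b by rewrite bE eq_sym eqNr.
    have rE : 0 ^+ 2 = a ^+ 2 - 4 * c%:C by rewrite a2 subrr expr0n.
    (* Here r = s = 0, and all four entries collapse to (0, 1) because a / a = 1. *)
    move=> z; rewrite (choices_branch _ _ c_gt0 _ _ 0 0 ab) // ?bE ?sqrrN //.
    rewrite opp_branch_choices // !inE oppr0 addr0 divff //.
    by rewrite !orbb.
split.
  move=> a r rE xp xm.
  (* The stated formulas are the diagonal parameters x = y, with r^2 replaced by a^2 - k. *)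
  have [xpE xmE] : shift_params _ c (a + r) (a + r) = xp /\
                   shift_params _ c (a - r) (a - r) = xm.
    have pE : (a + r) * (a + r) = 2 * a ^+ 2 + 2 * a * r - 4 * c%:C.
      by rewrite -expr2 sqrrD rE; ring.
    have mE : (a - r) * (a - r) = 2 * a ^+ 2 - 2 * a * r - 4 * c%:C.
      by rewrite -expr2 sqrrB rE; ring.
    have c0 : c%:C != 0 :> R[i] by rewrite fmorph_eq0 gt_eqF.
    by rewrite /xp /xm /shift_params pE mE; split; congr (_, _); field.
  split=> a2.
    have r0 : r != 0 by rewrite -sqrf_eq0 rE subr_eq0.
    split; last by move=> z; rewrite (choices_diag _ _ c_gt0 _ _ rE) (negPf r0) xpE xmE.
    by rewrite xpair_eqE (inj_eq (addrI a)) eq_sym eqNr (negPf r0).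
  have r0 : r = 0 by apply/eqP; rewrite -sqrf_eq0 rE a2 subrr.
  split; rewrite /xp /xm /= ?a2 ?r0 ?mulr0 ?subrr ?oppr0 ?addr0 ?mul0r //.
  move=> alpha beta sz eqG; apply/eqP; apply: contraT => beta0.
  (* A nonzero beta would give a member of [choices], which is empty for r = 0. *)
  have : (alpha, beta) \in choices c 2 (quad a a) by rewrite inE /= beta0 sz eqG.
  by rewrite (choices_diag _ _ c_gt0 _ _ rE) r0 eqxx.
move=> alpha beta _ /(size_G0_eq2 _ _ c_gt0)[-> alpha0]; split=> //.
  by move=> w; rewrite G0_half // rootZ ?oppr_eq0 // root_XsubC.
exact: choices_deg1.
Qed.
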